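(* The weight decomposition $$\Gamma(R^+)=\bigsqcup_{\alpha\in\Omega(R^+)}\Gamma(\alpha)$$ is the decomposition of $\Gamma(R^+)$ into connected components, i.e. every weight subgraph $\Gamma(\alpha)$, $\alpha\in\Omega(R^+)$, is a connected graph.
   Context: $R^+$ is the positive root system of a semisimple Lie algebra over $\mathbb C$ and $V$ is the real vector space spanned by $R^+$. Basis graph $\Gamma(R^+)$: its vertices are all subsets of $R^+$ (including $\emptyset$); $\{\sigma,\tau\}$ is an edge iff there are $e,e_1,e_2\in R^+$ with $e=e_1+e_2$ such that either $\sigma\setminus\tau=\{e\}$ and $\tau\setminus\sigma=\{e_1,e_2\}$, or $\tau\setminus\sigma=\{e\}$ and $\sigma\setminus\tau=\{e_1,e_2\}$. Weight: $\omega:\Gamma(R^+)\to V$, $\omega(\sigma)=\varrho-\sum_{e\in\sigma}e$ with $\varrho=\frac12\sum_{e\in R^+}e$; the weight set is $\Omega(R^+)=\operatorname{im}\omega$; for $\alpha\in\Omega(R^+)$ the weight subgraph $\Gamma(\alpha)$ is the full subgraph of $\Gamma(R^+)$ on the vertex set $\omega^{-1}(\alpha)$. (Adjacent vertices have the same weight, so $\Gamma(R^+)$ is the disjoint union of the graphs $\Gamma(\alpha)$.) *)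

(* Defs.v *)
From mathcomp Require Import all_boot all_order all_algebra.
From mathcomp Require Import finmap complex reals.

Set Implicit Arguments.
Unset Strict Implicit.
Unset Printing Implicit Defensive.

Import Order.TTheory GRing.Theory Num.Theory.
Local Open Scope ring_scope.

Section LieAlgebras.

Variables (F : fieldType) (L : vectType F).

Record lie_algebra := LieAlgebra {
  bracket :> L -> L -> L;
  bracket_linearl : forall y, linear (bracket^~ y);
  bracket_linearr : forall x, linear (bracket x);
  bracket_alternating : forall x, bracket x x = 0;
  bracket_jacobi : forall x y z,
    bracket x (bracket y z) + bracket y (bracket z x)
      + bracket z (bracket x y) = 0
}.

Variable g : lie_algebra.

Definition lie_ideal (I : {vspace L}) : Prop :=
  forall x y, y \in I -> g x y \in I.

(* By bilinearity, brackets of basis vectors span the same subspace [U, U] as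
   all the brackets [x, y] with x, y in U. *)
Definition derived (U : {vspace L}) : {vspace L} :=
  <<[seq g x y | x <- vbasis U, y <- vbasis U]>>%VS.

Definition lie_solvable (U : {vspace L}) : Prop :=
  exists n, iter n derived U = 0%VS.

(* The radical (the largest solvable ideal) is zero. *)
Definition lie_semisimple : Prop :=
  forall I : {vspace L}, lie_ideal I -> lie_solvable I -> I = 0%VS.

Definition lie_abelian (U : {vspace L}) : Prop :=
  {in U &, forall x y, g x y = 0}.

Definition ad_diagonalizable (x : L) : Prop :=
  exists2 b : seq L, basis_of fullv b &
    {in b, forall v, exists c : F, g x v = c *: v}.

(* A Cartan subalgebra of a semisimple Lie algebra over an algebraically
   closed field of characteristic 0, as in Helgason, Differential Geometry,
   Lie Groups, and Symmetric Spaces, Ch. III, Sect. 3: a maximal abelian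
   subalgebra whose elements are all ad-semisimple (i.e. ad-diagonalizable). *)
Definition cartan_subalgebra (h : {vspace L}) : Prop :=
  [/\ lie_abelian h,
      forall h' : {vspace L}, lie_abelian h' -> (h <= h')%VS -> h' = h
    & {in h, forall x, ad_diagonalizable x}].

Definition dual (h : {vspace L}) := 'Hom(subvs_of h, F^o).

Definition lie_root (h : {vspace L}) (a : dual h) : Prop :=
  a != 0 /\
  exists2 x : L, x != 0 & forall t : subvs_of h, g (vsval t) x = a t *: x.

(* R^+ is finite by typing; this entails that the set of all roots, being
   R^+ together with - R^+, is finite, which always holds. *)
Definition positive_root_system (h : {vspace L}) (Rp : {fset dual h}) : Prop :=
  [/\ forall a, a \in Rp -> lie_root a,
      forall a, lie_root a -> (a \in Rp) (+) (- a \in Rp)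
    & forall a b, a \in Rp -> b \in Rp -> lie_root (a + b) -> a + b \in Rp].

End LieAlgebras.

Section Graphs.

Variables (T : finType) (e : rel T).

Definition connected_components : {set {set T}} :=
  equivalence_partition (connect e) [set: T].

(* The full subgraph of e on the vertex set A is a connected graph. *)
Definition connected_subgraph (A : {set T}) : Prop :=
  A != set0 /\
  {in A &, forall x y, connect [rel u v | [&& u \in A, v \in A & e u v]] x y}.

End Graphs.

Section BasisGraph.

Variables (R : realType) (L : vectType R[i]) (h : {vspace L}).
Variable Rp : {fset dual h}.

Definition basis_edge : rel {set Rp} := fun s t =>
  [exists e : Rp, exists e1 : Rp, exists e2 : Rp,
    (val e == val e1 + val e2) &&
    ((s :\: t == [set e]) && (t :\: s == [set e1; e2])
     || (t :\: s == [set e]) && (s :\: t == [set e1; e2]))].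

Definition rho : dual h := 2%:R^-1 *: \sum_(e : Rp) val e.

Definition omega (s : {set Rp}) : dual h := rho - \sum_(e in s) val e.

(* The real vector space V spanned by R^+, inside the complex dual of h. *)
Definition in_real_span (v : dual h) : Prop :=
  exists c : Rp -> R, v = \sum_(e : Rp) (c e)%:C%C *: val e.

Lemma omega_in_real_span (s : {set Rp}) : in_real_span (omega s).
Proof.
exists (fun e => 2%:R^-1 - (e \in s)%:R).
rewrite /omega /rho scaler_sumr [X in _ - X]big_mkcond -sumrB.
apply: eq_bigr => e _; rewrite rmorphB fmorphV !rmorph_nat scalerBl.
by case: ifP => _; rewrite ?scale1r ?scale0r.
Qed.

Definition weight_set : {fset dual h} := [fset omega s | s : {set Rp}]%fset.

Definition weight_vertices (a : dual h) : {set {set Rp}} :=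
  [set s | omega s == a].

Definition weight_decomposition : {set {set {set Rp}}} :=
  [set weight_vertices (val a) | a : weight_set].

End BasisGraph.

(* Main.v *)
(* Let A = s \ t and B = t \ s for two vertices s, t of the same weight, and let
   S = A u (-B), a set of roots with zero sum and no pair of opposite roots. A
   nonempty finite list of elements of a set of roots that is closed under sums
   and contains no opposite pairs has nonzero sum: if the list starts with a, then
   evaluation at the coroot of a shows that a + b is 0 or a root for some later
   entry b, and the list can be shortened. So if s <> t then S is not closed, and
   x + y is a root outside S for some x, y in S. Flipping s or t along this relation
   shrinks their symmetric difference.

   The root-theoretic input is the existence of an sl2-triple for each root and
   that twice a root is not a root. Weight vectors u of nonzero weight b with
   [u, g_(-b)] = 0 span an ideal, because the Killing form vanishes between u and
   g_(-b) but is nonzero at (t, t) for every nonzero bracket t of two opposite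
   root vectors. This ideal has no zero weights, so it is nilpotent by Engel's
   argument, and by semisimplicity it is 0. *)
Require Import Defs.
From mathcomp Require Import all_boot all_order all_algebra.
From mathcomp Require Import finmap complex reals.
From HB Require Import structures.
From mathcomp Require Import boolp ring.

Set Implicit Arguments.
Unset Strict Implicit.
Unset Printing Implicit Defensive.

Import Order.TTheory GRing.Theory Num.Theory.
Local Open Scope ring_scope.

(** * Subspaces cut out by arbitrary propositions *)

Section Subspaces.

Variables (F : fieldType) (L : vectType F).

(** Each vector of [P] outside the current span raises its dimension, which is bounded by that of
    [L]. *)
Lemma span_pred (P : L -> Prop) :
  exists2 X : seq L, forall x, x \in X -> P x & forall x, P x -> x \in <<X>>%VS.
Proof.
suff /(_ (\dim {:L}).+1) [X [PX [|]]] : forall n, exists X : seq L,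
    (forall x, x \in X -> P x) /\
    ((forall x, P x -> x \in <<X>>%VS) \/ (n <= \dim <<X>>)%N).
- by exists X.
- by rewrite ltnNge dimvS ?subvf.
elim=> [|n [X [PX [cX|le_n]]]]; first by exists [::]; split; [|right].
  by exists X; split; [|left].
have [cX|/existsNP[x /not_implyP[Px /negP xX]]] :=
  pselect (forall x, P x -> x \in <<X>>%VS); first by exists X; split; [|left].
exists (x :: X); split=> [y|]; first by rewrite inE => /predU1P[->|/PX].
right; apply: leq_ltn_trans le_n _.
have sX : (<<X>> <= <<x :: X>>)%VS by rewrite span_cons addvSr.
rewrite ltn_neqAle dimvS // andbT (dimv_leqif_sup sX).
by apply: contra xX => /subvP; apply; rewrite memv_span ?mem_head.
Qed.

(** Turns undecidable linear conditions, such as being killed by a power of an operator, into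
    subspaces: the span of a list of elements of [P] stays in [P]. *)
Lemma vspace_comprehension (P : L -> Prop) :
    P 0 -> (forall a x y, P x -> P y -> P (a *: x + y)) ->
  exists U : {vspace L}, forall x, x \in U <-> P x.
Proof.
move=> P0 PD; have [X PX cX] := span_pred P.
exists <<X>>%VS => x; split=> [|/cX //].
elim: X {cX} x PX => [|u X IH] x PX.
  by rewrite span_nil memv0 => /eqP->.
rewrite span_cons => /memv_addP[_ /vlineP[k ->]] [v vX ->].
apply: PD; first by apply: PX; rewrite mem_head.
by apply: IH vX => y yX; apply: PX; rewrite inE yX orbT.
Qed.

End Subspaces.

(** * Traces of endomorphisms *)

Section TraceOfEndomorphism.

Import passmx.

Variables (F : fieldType) (L : vectType F).
Implicit Types f k : 'End(L).

Definition lftrace f : F := \tr (mxof (vbasis {:L}) (vbasis {:L}) f).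

Lemma lftraceB f k : lftrace (f - k) = lftrace f - lftrace k.
Proof. by rewrite /lftrace linearB /= linearB. Qed.

Lemma lftraceZ a f : lftrace (a *: f) = a * lftrace f.
Proof. by rewrite /lftrace linearZ /= linearZ. Qed.

(** Change of basis: insert the identity and use that the trace of a product is cyclic. *)
Lemma lftrace_basis (b : (\dim {:L}).-tuple L) f :
  basis_of fullv b -> lftrace f = \tr (mxof b b f).
Proof.
move=> bb; have eb := vbasisP {:L}; rewrite /lftrace.
rewrite -[X in mxof _ _ X]comp_lfun1l (mxof_comp _ _ bb) mxtrace_mulC.
by rewrite -(mxof_comp _ _ eb) comp_lfun1r.
Qed.

Lemma lftraceC f k : lftrace (f \o k)%VF = lftrace (k \o f)%VF.
Proof.
have eb := vbasisP {:L}.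
by rewrite /lftrace !(mxof_comp _ _ eb) mxtrace_mulC.
Qed.

Lemma lftrace_diag (b : (\dim {:L}).-tuple L) f (c : 'I_(\dim {:L}) -> F) :
    basis_of fullv b -> (forall i : 'I_(\dim {:L}), f b`_i = c i *: b`_i) ->
  lftrace f = \sum_i c i.
Proof.
move=> bb fb; rewrite (lftrace_basis _ bb); apply: eq_bigr => i _.
rewrite !mxE /= vecof_delta fb linearZ /=.
by rewrite coord_free ?(basis_free bb) // eqxx mulr1.
Qed.

End TraceOfEndomorphism.

(** * Brackets and simultaneous diagonalization *)

Section LieBasics.

Variables (F : fieldType) (L : vectType F) (g : lie_algebra L).
Implicit Types (U W : {vspace L}) (u v x y : L).

HB.instance Definition _ x :=
  GRing.isLinear.Build F L L *:%R (bracket g x) (bracket_linearr g x).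

Lemma bracketDl x y z : g (x + y) z = g x z + g y z.
Proof. by have := bracket_linearl g z 1 x y; rewrite /= !scale1r. Qed.

Lemma bracketDr x y z : g x (y + z) = g x y + g x z.
Proof. exact: linearD. Qed.

Lemma bracket0l x : g 0 x = 0.
Proof. by apply: (addrI (g 0 x)); rewrite -bracketDl !addr0. Qed.

Lemma bracket0r x : g x 0 = 0.
Proof. exact: linear0. Qed.

Lemma bracketZl a x y : g (a *: x) y = a *: g x y.
Proof.
by have := bracket_linearl g y a x 0; rewrite /= !addr0 bracket0l addr0.
Qed.

Lemma bracketZr a x y : g x (a *: y) = a *: g x y.
Proof. exact: linearZ. Qed.

Lemma bracketC x y : g x y = - g y x.
Proof.
apply/eqP; rewrite -addr_eq0; apply/eqP.
have := bracket_alternating g (x + y).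
by rewrite bracketDl !bracketDr !bracket_alternating add0r addr0.
Qed.

Lemma bracketA x y z : g x (g y z) = g (g x y) z + g y (g x z).
Proof.
have /eqP := bracket_jacobi g x y z.
rewrite [g z x]bracketC [g z (g x y)]bracketC linearN /= -addrA -opprD subr_eq0.
by rewrite addrC => /eqP.
Qed.

Definition ad x : 'End(L) := linfun (g x).

Lemma adE x y : ad x y = g x y.
Proof. exact: lfunE. Qed.

Definition stabilizes (x : L) (U : {vspace L}) :=
  forall u, u \in U -> g x u \in U.

Definition shift t c : 'End(L) := ad t - c *: \1%VF.

Lemma shiftE t c v : shift t c v = g t v - c *: v.
Proof. by rewrite /shift !lfun_simp. Qed.

Lemma shift_eq0 t c v : shift t c v = 0 <-> g t v = c *: v.
Proof. by rewrite shiftE; split=> [/subr0_eq|->]; rewrite ?subrr. Qed.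

(** This is [p(ad t)] for the monic split polynomial [p] with root list [cs]. *)
Definition shifts t (cs : seq F) : 'End(L) :=
  foldr (fun c f => shift t c \o f)%VF \1%VF cs.

Lemma shifts_cons t c cs v : shifts t (c :: cs) v = shift t c (shifts t cs v).
Proof. by rewrite /shifts /= comp_lfunE. Qed.

Lemma shifts_eigen t cs v l :
  g t v = l *: v -> shifts t cs v = (\prod_(c <- cs) (l - c)) *: v.
Proof.
move=> tv; elim: cs => [|c cs IH]; first by rewrite big_nil scale1r id_lfunE.
rewrite shifts_cons IH shiftE bracketZr tv big_cons !scalerA -scalerBl.
by congr (_ *: _); rewrite mulrBl mulrC.
Qed.

Lemma shifts_stable t cs W v :
  stabilizes t W -> v \in W -> shifts t cs v \in W.
Proof.
move=> tW vW; elim: cs => [|c cs IH]; first by rewrite id_lfunE.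
by rewrite shifts_cons shiftE memvB ?memvZ ?tW.
Qed.

(** The roots are the eigenvalues on an eigenbasis; dropping repetitions makes them simple, which is
    what allows eigenvectors to be split off. *)
Lemma ad_diagonalizable_annihilator t : ad_diagonalizable g t ->
  exists2 cs, uniq cs & forall v, shifts t cs v = 0.
Proof.
case=> b bb bE.
have [cs csP]: exists cs : seq F,
    {in b, forall v, exists2 c, c \in cs & g t v = c *: v}.
  elim: b {bb} bE => [|u b IH] bE; first by exists [::].
  have [v vb|cs csP] := IH; first by apply: bE; rewrite inE vb orbT.
  have [c cu] := bE u (mem_head _ _); exists (c :: cs) => v.
  rewrite inE => /predU1P[->|/csP[d dcs dv]]; first by exists c; rewrite ?mem_head.
  by exists d; rewrite ?inE ?dcs ?orbT.
exists (undup cs) => [|v]; first exact: undup_uniq.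
suff /subvP/(_ v (memvf v)) : (fullv <= lker (shifts t (undup cs)))%VS.
  by rewrite memv_ker => /eqP.
rewrite -(span_basis bb); apply/span_subvP => u /csP[c ccs cu].
rewrite memv_ker (shifts_eigen _ cu) (big_rem c) ?mem_undup //=.
by rewrite subrr mul0r scale0r.
Qed.

(* If w in W is killed by (t - l) p(t) with p(l) <> 0, then p(t) w is an
   eigenvector and w - p(t) w / p(l) is killed by p(t). *)
Lemma stable_subspace_eigen t W U : ad_diagonalizable g t -> stabilizes t W ->
    (forall v c, v \in W -> g t v = c *: v -> v \in U) ->
  (W <= U)%VS.
Proof.
move=> /ad_diagonalizable_annihilator[cs cs_uniq cs0] tW eU.
apply/subvP => w wW; elim: cs cs_uniq w wW {cs0}(cs0 w) => [_ w _|l cs IH].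
  by rewrite id_lfunE => ->; rewrite mem0v.
move=> /andP[l_cs cs_uniq] w wW; set u := shifts t cs w.
rewrite shifts_cons => /shift_eq0 tu; set p := \prod_(c <- cs) (l - c).
have uW : u \in W by apply: shifts_stable.
have uU : u \in U by apply: eU uW tu.
have p0 : p != 0.
  rewrite prodf_seq_neq0; apply/allP => c ccs /=; rewrite subr_eq0.
  by apply: contraNneq l_cs => ->.
rewrite -[w](subrK (p^-1 *: u)) memvD ?memvZ //; apply: IH => //.
  by rewrite memvB ?memvZ.
by rewrite linearB linearZ /= (shifts_eigen _ tu) scalerA mulVf // scale1r subrr.
Qed.

(** Restrict to an eigenspace of the first operator; the others preserve it because they commute
    with it. *)
Lemma commuting_eigen (ts : seq L) W U :
    {in ts, forall t, ad_diagonalizable g t} ->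
    {in ts &, forall s t, g s t = 0} ->
    {in ts, forall t, stabilizes t W} ->
    (forall v, v \in W -> {in ts, forall t, exists c, g t v = c *: v} ->
      v \in U) ->
  (W <= U)%VS.
Proof.
elim: ts W => [|t ts IH] W diag comm stab eU.
  by apply/subvP => v /eU; apply.
have sub s : s \in ts -> s \in t :: ts by rewrite inE orbC => ->.
apply: (@stable_subspace_eigen t); [|exact/stab/mem_head|move=> v c vW tv].
  exact/diag/mem_head.
have vWc : v \in (W :&: lker (shift t c))%VS.
  by rewrite memv_cap vW memv_ker; apply/eqP/shift_eq0.
apply: (subvP (IH _ _ _ _ _)) vWc => [s /sub/diag //||s ts_s u|u].
- by move=> s1 s2 /sub s1t /sub /(comm _ _ s1t).
- rewrite !memv_cap !memv_ker => /andP[uW /eqP/shift_eq0 tu].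
  rewrite stab ?sub //=; apply/eqP/shift_eq0.
  by rewrite bracketA (comm t s) ?mem_head ?sub // bracket0l add0r tu bracketZr.
- rewrite memv_cap memv_ker => /andP[uW /eqP/shift_eq0 tu] su.
  by apply: eU => // s; rewrite inE => /predU1P[->|/su]; first by exists c.
Qed.

Definition locally_nilpotent x := forall v, exists k, iter k (g x) v = 0.

Lemma iter_bracket0 x k m v :
  iter k (g x) v = 0 -> (k <= m)%N -> iter m (g x) v = 0.
Proof.
move=> kv /subnK <-; rewrite iterD kv.
by elim: (m - k)%N => //= n ->; rewrite bracket0r.
Qed.

Lemma iter_bracketP x k a u v :
  iter k (g x) (a *: u + v) = a *: iter k (g x) u + iter k (g x) v.
Proof. by elim: k => //= k ->; rewrite linearP. Qed.

(** When [ad x] raises weights, this last nonzero iterate is a highest weight vector. *)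
Lemma iter_last_nonzero x v : locally_nilpotent x -> v != 0 ->
  exists2 k, iter k (g x) v != 0 & iter k.+1 (g x) v = 0.
Proof.
move=> /(_ v) xv v0.
have := ex_minnP (P := fun k => iter k (g x) v == 0) _.
case: xv => k /eqP kv /(_ (ex_intro _ k kv)) [] [|m]; first by rewrite /= (negPf v0).
move=> /eqP mv min_m; exists m => //.
by apply/negP => /min_m; rewrite ltnn.
Qed.

End LieBasics.

(** * Ladders of eigenvectors and the Killing form *)

Section Ladders.

Variables (F : numFieldType) (L : vectType F) (g : lie_algebra L).
Implicit Types (c l : F) (t u v x y : L).

Lemma iter_eigen t y d v l k : g t y = d *: y -> g t v = l *: v ->
  g t (iter k (g y) v) = (l + k%:R * d) *: iter k (g y) v.
Proof.
move=> ty tv; elim: k => [|k IH]; first by rewrite mul0r addr0.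
rewrite iterS bracketA ty IH bracketZl bracketZr -scalerDl; congr (_ *: _).
by rewrite -natr1; ring.
Qed.

(** Since [ad y] shifts [t]-eigenvalues by [d], an eigenvector that no power of [ad y] kills would
    give [ad t] infinitely many eigenvalues. *)
Lemma ad_diagonalizable_nilpotent t y d : ad_diagonalizable g t ->
  g t y = d *: y -> d != 0 -> locally_nilpotent g y.
Proof.
move=> t_diag ty d0.
have [N NP] : exists N : {vspace L},
    forall v, v \in N <-> exists k, iter k (g y) v = 0.
  apply: vspace_comprehension => [|a u v [j ju] [k kv]]; first by exists 0.
  exists (maxn j k); rewrite iter_bracketP.
  rewrite (iter_bracket0 ju) ?leq_maxl // (iter_bracket0 kv) ?leq_maxr //.
  by rewrite scaler0 addr0.
suff /subvP fN : (fullv <= N)%VS by move=> v; apply/NP/fN/memvf.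
apply: (stable_subspace_eigen t_diag) => [u _|v l _ tv]; first exact: memvf.
have [cs _ cs0] := ad_diagonalizable_annihilator t_diag.
apply/NP; apply: contrapT => /forallNP ny.
(* One eigenvalue more than the annihilating polynomial has roots. *)
pose s := [seq l + k%:R * d | k <- iota 0 (size cs).+1].
have s_uniq : uniq s.
  rewrite map_inj_uniq ?iota_uniq // => j k /addrI /(mulIf d0) /eqP.
  by rewrite eqr_nat => /eqP.
have : {subset s <= cs}.
  move=> _ /mapP[k _ ->]; have /eqP := cs0 (iter k (g y) v).
  rewrite (shifts_eigen _ (iter_eigen k ty tv)) scaler_eq0 => /orP[|/eqP/ny //].
  rewrite prodf_seq_eq0 => /hasP[c ccs] /=.
  by rewrite subr_eq0 => /eqP->.
by move/(uniq_leq_size s_uniq); rewrite size_map size_iota ltnn.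
Qed.

Section HighestWeight.

Variables (x y t : L) (c : F).
Hypotheses (xy : g x y = t) (tx : g t x = c *: x) (ty : g t y = - c *: y).

(** The coefficient is the sum of [l - j c] over [0 <= j <= k]. The triple is not normalized and [c]
    may be 0, so that the formula applies before [c] is known to be nonzero. *)
Lemma bracket_ladder v l k : g x v = 0 -> g t v = l *: v ->
  g x (iter k.+1 (g y) v)
    = (k.+1%:R * (l - k%:R * c / 2)) *: iter k (g y) v.
Proof.
move=> xv tv; elim: k => [|k IH].
  by rewrite /= bracketA xy xv bracket0r addr0 tv !mul0r subr0 mul1r.
rewrite iterS bracketA xy IH (iter_eigen _ ty tv) bracketZr -iterS -scalerDl.
by congr (_ *: _); rewrite -!natr1; field.
Qed.

(** At the last nonzero iterate of [ad y] the ladder coefficient has to vanish. *)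
Lemma highest_weight_nat v l : locally_nilpotent g y -> v != 0 ->
  g x v = 0 -> g t v = l *: v -> exists n : nat, l *+ 2 = n%:R * c.
Proof.
move=> y_nil v0 xv tv; have [n nv Sn] := iter_last_nonzero y_nil v0.
exists n; have /eqP := bracket_ladder n xv tv.
rewrite Sn bracket0r eq_sym scaler_eq0 (negPf nv) orbF mulf_eq0 pnatr_eq0 /=.
by rewrite subr_eq0 -mulr_natr => /eqP->; field.
Qed.

Lemma eigenvalue_int v l : locally_nilpotent g x -> locally_nilpotent g y ->
  v != 0 -> g t v = l *: v -> exists m : int, l *+ 2 = m%:~R * c.
Proof.
move=> x_nil y_nil v0 tv; have [k kv Sk] := iter_last_nonzero x_nil v0.
have [n nE] := highest_weight_nat y_nil kv Sk (iter_eigen k tx tv).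
(* The highest weight vector above [v] has eigenvalue [l + k c], whence [2 l = (n - 2 k) c]. *)
exists (n%:Z - k%:Z *+ 2).
rewrite rmorphB rmorphMn /= -!pmulrn mulrBl -nE.
by ring.
Qed.

(** Takes the place of Cartan's criterion: the eigenvalues of [ad t] are [m c / 2] with [m] an
    integer, so the trace is [c ^ 2 / 4] times a sum of integer squares. The factor [c] in the
    hypothesis covers [c = 0], where all eigenvalues vanish anyway. *)
Lemma ad_square_trace0 : ad_diagonalizable g t ->
    locally_nilpotent g x -> locally_nilpotent g y ->
    c * lftrace (ad g t \o ad g t)%VF = 0 ->
  forall v, g t v = 0.
Proof.
move=> [b bb bE] x_nil y_nil tr0.
have sz : size b == \dim {:L} by rewrite -(span_basis bb) (eqP (basis_free bb)).
pose bt := Tuple sz.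
have [m mE] : exists m : 'I_(\dim {:L}) -> int,
    forall i : 'I_(\dim {:L}), g t bt`_i = ((m i)%:~R * c / 2) *: bt`_i.
  suff /choice[m mE] : forall i : 'I_(\dim {:L}), exists m : int,
    g t bt`_i = (m%:~R * c / 2) *: bt`_i by exists m.
  move=> i; have bi : bt`_i \in b by rewrite mem_nth // (eqP sz).
  have [l tl] := bE _ bi.
  have [m mE] := eigenvalue_int x_nil y_nil (basis_not0 bb bi) tl.
  by exists m; rewrite tl -mE -[l *+ 2]mulr_natr mulfK ?pnatr_eq0.
suff c0 i : (m i)%:~R * c / 2 = 0.
  move=> v; rewrite [v](@coord_basis _ _ fullv _ bt) ?memvf //.
  rewrite linear_sum big1 //= => i _.
  by rewrite bracketZr mE c0 scale0r scaler0.
have [->|c0] := eqVneq c 0; first by rewrite mulr0 mul0r.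
move/eqP: tr0; rewrite mulf_eq0 (negPf c0) /=.
pose e i := ((m i)%:~R * c / 2) ^+ 2.
rewrite (lftrace_diag (b := bt) (c := e)) //; last first.
  by move=> j; rewrite comp_lfunE !adE mE bracketZr mE scalerA.
under eq_bigr do rewrite /e -mulrA exprMn.
rewrite -mulr_suml mulf_eq0 orbC expf_eq0 /= mulf_eq0 (negPf c0) invr_eq0.
rewrite pnatr_eq0 /=.
rewrite psumr_eq0 => [/allP/(_ i)|j _]; last first.
  by rewrite -rmorphXn /= ler0z sqr_ge0.
by rewrite mem_index_enum /= expf_eq0 /= => /(_ isT)/eqP->; rewrite !mul0r.
Qed.

End HighestWeight.

Definition killing x y : F := lftrace (ad g x \o ad g y)%VF.

Lemma ad_bracket x y :
  ad g (g x y) = ((ad g x \o ad g y) - (ad g y \o ad g x))%VF.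
Proof.
apply/lfunP => v; rewrite add_lfunE opp_lfunE !comp_lfunE !adE.
by rewrite [g x (g y v)]bracketA addrK.
Qed.

(** Expand both brackets as commutators and rotate one of the traces. *)
Lemma killing_invariant x y z : killing (g x y) z = killing x (g y z).
Proof.
rewrite /killing !ad_bracket comp_lfunDl comp_lfunDr comp_lfunNl comp_lfunNr.
by rewrite !lftraceB -!comp_lfunA [X in _ - X]lftraceC -comp_lfunA.
Qed.

Lemma killingZl a x y : killing (a *: x) y = a * killing x y.
Proof.
rewrite /killing -lftraceZ comp_lfunZl; congr (lftrace (_ \o _)%VF).
by apply/lfunP => v; rewrite scale_lfunE !adE bracketZl.
Qed.

Lemma killingC x y : killing x y = killing y x.
Proof. exact: lftraceC. Qed.

Lemma killing0r x : killing x 0 = 0.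
Proof.
have ad0 : ad g 0 = 0 by apply/lfunP=> v; rewrite adE bracket0l zero_lfunE.
rewrite /killing ad0.
by rewrite comp_lfun0r -[X in lftrace X](scale0r (\1)%VF) lftraceZ mul0r.
Qed.

Lemma killingZr a x y : killing x (a *: y) = a * killing x y.
Proof. by rewrite killingC killingZl killingC. Qed.

End Ladders.

(** * Engel's argument and sl2-triples *)

Section Engel.

Variables (F : fieldType) (L : vectType F) (g : lie_algebra L).
Implicit Types (U W K : {vspace L}) (u v x y : L).

(* K acts nilpotently on every subquotient W / U. *)
Definition has_null_vectors K := forall U W,
  ~~ (W <= U)%VS -> {in K, forall k, stabilizes g k U} ->
  {in K, forall k, stabilizes g k W} ->
  exists w, [/\ w \in W, w \notin U & {in K, forall k, g k w \in U}].

Lemma has_null_vectors0 : has_null_vectors 0%VS.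
Proof.
move=> U W /subvPn[w wW wU] _ _; exists w; split=> // k.
by rewrite memv0 => /eqP->; rewrite bracket0l mem0v.
Qed.

(** Apply powers of [ad x] to a vector that [K] sends into [U]. As [x] normalizes [K], the iterates
    keep this property, and the last one before [U] is reached is sent into [U] by [x] as well. *)
Lemma has_null_vectors_extend K x : has_null_vectors K ->
  stabilizes g x K -> locally_nilpotent g x -> has_null_vectors (K + <[x]>)%VS.
Proof.
move=> K_null xK x_nil U W sWU stabU stabW.
have sub k : k \in K -> k \in (K + <[x]>)%VS by apply/subvP/addvSl.
have xKx : x \in (K + <[x]>)%VS by apply/(subvP (addvSr _ _))/memv_line.
have [k /sub /stabU //|k /sub /stabW //|w0 [w0W w0U w0K]] := K_null U W sWU.
pose w j := iter j (g x) w0.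
have wP j : w j \in W /\ {in K, forall k, g k (w j) \in U}.
  elim: j => [//|j [IHW IHK]]; split=> [|k kK]; first exact: stabW.
  have kxK : g k x \in K by rewrite bracketC memvN xK.
  by rewrite /w iterS bracketA memvD ?(stabU x) ?IHK.
have [k0 k0P] : exists j, w j \in U.
  by have [j jP] := x_nil w0; exists j; rewrite /w jP mem0v.
case: (ex_minnP (ex_intro (fun j => w j \in U) _ k0P)) => -[|m] mU m_min.
  by rewrite mU in w0U.
have [mW mK] := wP m; exists (w m); split=> //.
  by apply/negP => /m_min; rewrite ltnn.
move=> _ /memv_addP[k kK [_ /vlineP[c ->] ->]].
by rewrite bracketDl bracketZl memvD ?mK // memvZ.
Qed.

End Engel.

(** * Weight vectors of a Cartan subalgebra *)

Section Cartan.

Variables (F : numFieldType) (L : vectType F) (g : lie_algebra L).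
Variable h : {vspace L}.
Hypotheses (g_semisimple : lie_semisimple g) (h_cartan : cartan_subalgebra g h).
Implicit Types (U W K M : {vspace L}) (t u v x y z : L) (a b : L -> F).

Let h_abelian : {in h &, forall s t, g s t = 0}.
Proof. by case: h_cartan. Qed.

Let h_diag : {in h, forall t, ad_diagonalizable g t}.
Proof. by case: h_cartan. Qed.

Lemma abelian_ideal0 M : lie_ideal g M -> lie_abelian g M -> M = 0%VS.
Proof.
move=> idM abM; apply: g_semisimple => //; exists 1%N => /=.
apply/eqP; rewrite -subv0; apply/span_subvP => _ /allpairsP[[x y] /= [xM yM ->]].
by rewrite abM ?mem0v ?vbasis_mem.
Qed.

Lemma center0 t : (forall v, g t v = 0) -> t = 0.
Proof.
move=> t0; suff: <[t]>%VS = 0%VS by move/eqP; rewrite -subv0 -memvE memv0 => /eqP.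
apply: abelian_ideal0 => [x _ /vlineP[k ->]|_ y /vlineP[k ->] _].
  by rewrite bracketZr bracketC t0 oppr0 scaler0 mem0v.
by rewrite bracketZl t0 scaler0.
Qed.

(** Adjoining [v] to [h] gives an abelian subspace, so maximality of [h] applies. *)
Lemma centralizer_cartan v : {in h, forall t, g t v = 0} -> v \in h.
Proof.
move=> hv; have [_ h_max _] := h_cartan.
rewrite -(h_max (h + <[v]>)%VS) ?addvSl //.
  exact/(subvP (addvSr _ _))/memv_line.
move=> _ _ /memv_addP[s sh [_ /vlineP[c ->] ->]]
  /memv_addP[t th [_ /vlineP[d ->] ->]].
rewrite bracketDl !bracketDr !bracketZl !bracketZr h_abelian // hv //.
by rewrite bracketC hv // bracket_alternating !(oppr0, scaler0, addr0).
Qed.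

(** A weight is a bare function on [L] of which only the values on [h] count; this lets weights be
    added and negated pointwise. *)
Definition wt a v := {in h, forall t, g t v = a t *: v}.

Definition nonzero_wt a := exists2 t, t \in h & a t != 0.

Lemma wt_bracket a b u v :
  wt a u -> wt b v -> wt (fun t => a t + b t) (g u v).
Proof.
by move=> au bv t th; rewrite bracketA (au t) // (bv t) // bracketZl bracketZr scalerDl.
Qed.

Lemma wtZ a c v : wt a v -> wt a (c *: v).
Proof. by move=> av t th; rewrite bracketZr av // !scalerA mulrC. Qed.

Lemma eq_wt a b v : {in h, a =1 b} -> wt a v -> wt b v.
Proof. by move=> ab av t th; rewrite av // ab. Qed.

Lemma wt0_cartan a v : {in h, forall t, a t = 0} -> wt a v -> v \in h.
Proof.
by move=> a0 av; apply: centralizer_cartan => t th; rewrite av // a0 // scale0r.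
Qed.

(** An [h]-stable subspace is spanned by its weight vectors. *)
Lemma subspace_wt W U : {in h, forall t, stabilizes g t W} ->
  (forall a v, v \in W -> wt a v -> v \in U) -> (W <= U)%VS.
Proof.
move=> hW wU; apply: (@commuting_eigen _ _ g (vbasis h)).
- by move=> t /vbasis_mem/h_diag.
- by move=> s t /vbasis_mem sh /vbasis_mem th; apply: h_abelian.
- by move=> t /vbasis_mem/hW.
move=> v vW ev; suff /choice[a av] : forall t, exists c, t \in h -> g t v = c *: v.
  by apply: (wU a).
move=> t; have [th|_] := boolP (t \in h); last by exists 0.
(* A common eigenvector for a basis of [h] is one for all of [h], because the elements that send [v]
   into its own line form a subspace. *)
suff /subvP/(_ t th) : (h <= ad g v @^-1: <[v]>)%VS.
  rewrite -memv_preim adE => /vlineP[c cE]; exists (- c) => _.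
  by rewrite bracketC cE scaleNr.
rewrite -(span_basis (vbasisP h)); apply/span_subvP => s /ev[c sv].
by rewrite -memv_preim adE bracketC sv memvN memvZ ?memv_line.
Qed.

Lemma wt_nilpotent a x : wt a x -> nonzero_wt a -> locally_nilpotent g x.
Proof.
move=> ax [t th at0].
exact: ad_diagonalizable_nilpotent (h_diag th) (ax t th) at0.
Qed.

(* Composing the shifts [ad t - a t] over the list kills the span, but acts on
   weight zero as a nonzero scalar. *)
Lemma span_nonzero_wt_cartan (X : seq L) :
    {in X, forall x, exists2 a, wt a x & nonzero_wt a} ->
  forall v, v \in <<X>>%VS -> v \in h -> v = 0.
Proof.
move=> Xwt; have [f [e [e0 fX fh]]] : exists (f : 'End(L)) (e : F),
    [/\ e != 0, {in X, forall x, f x = 0} & {in h, forall v, f v = e *: v}].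
  elim: X Xwt => [|x X IH] Xwt.
    exists \1%VF, 1; split=> [||v _]; rewrite ?oner_neq0 //.
    by rewrite id_lfunE scale1r.
  have [y yX|f [e [e0 fX fh]]] := IH; first by apply: Xwt; rewrite inE yX orbT.
  have [a ax [t th at0]] := Xwt x (mem_head _ _).
  exists (f \o shift g t (a t))%VF, (- a t * e); split.
  - by rewrite mulf_neq0 ?oppr_eq0.
  - move=> y yX; have [b yb _] := Xwt y yX; rewrite comp_lfunE.
    move: yX; rewrite inE => /predU1P[->|/fX fy].
      by have /shift_eq0-> := ax t th; rewrite linear0.
    by rewrite shiftE yb // -scalerBl linearZ /= fy scaler0.
  - move=> v vh; rewrite comp_lfunE shiftE h_abelian // sub0r -scaleNr.
    by rewrite linearZ /= fh // scalerA.
move=> v /(subvP (_ : <<X>> <= lker f)%VS) vf vh.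
move: vf; rewrite memv_ker fh // scaler_eq0 (negPf e0) => vf.
by apply/eqP/vf/span_subvP => x /fX fx; rewrite memv_ker fx.
Qed.

(* Engel's argument: a maximal h-stable subalgebra K of M acting nilpotently is
   M itself, since otherwise K is normalized by a weight vector of M outside K. *)
Lemma ideal_no_wt0 M : lie_ideal g M ->
    (forall v, v \in M -> v \in h -> v = 0) ->
  M = 0%VS.
Proof.
move=> idM Mh0; apply/eqP; apply: contraT => M0.
have wtM a v : v \in M -> wt a v -> v != 0 -> nonzero_wt a.
  move=> vM av; apply: contra_neqP => /forall2NP a0; apply: Mh0 => //.
  apply: (wt0_cartan _ av) => t th; have [//|/negP] := a0 t.
  by rewrite negbK => /eqP.
have stabM x : stabilizes g x M by move=> u; apply: idM.
have [K [sKM dK K_alg hK K_null]] : exists K,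
    [/\ (K <= M)%VS, (\dim M <= \dim K)%N,
    {in K, forall k, stabilizes g k K}, {in h, forall t, stabilizes g t K}
    & has_null_vectors g K].
  (* Induction on [n <= \dim M], asking for such a [K] of dimension at least [n]. *)
  elim: {-2}(\dim M) (leqnn (\dim M)) => [_|n IH ltn].
    exists 0%VS; split; rewrite ?sub0v //; last exact: has_null_vectors0.
      by move=> k _ u; rewrite !memv0 => /eqP->; rewrite bracket0r.
    by move=> k _ u; rewrite !memv0 => /eqP->; rewrite bracket0r.
  have [K [sKM dK K_alg hK K_null]] := IH (ltnW ltn).
  have [ltnK|leKn] := ltnP n (\dim K); first by exists K.
  have sMK : ~~ (M <= K)%VS.
    by apply: contraL leKn => /dimvS leMK; rewrite -ltnNge (leq_trans ltn).
  (* [W] is the normalizer of [K] in [M]; a null vector of [M] modulo [K] lies in [W] but not in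
     [K]. *)
  have [W WP] : exists W, forall w,
      w \in W <-> w \in M /\ {in K, forall k, g k w \in K}.
    apply: vspace_comprehension => [|c u v [uM uK] [vM vK]].
      by split=> [|k _]; rewrite ?bracket0r mem0v.
    split=> [|k kK]; first by rewrite memvD ?memvZ.
    by rewrite bracketDr bracketZr memvD ?memvZ ?uK ?vK.
  have sWK : ~~ (W <= K)%VS.
    have [w [wM wK Kw]] := K_null K M sMK K_alg (fun k _ => stabM k).
    by apply: contra wK => /subvP; apply; apply/WP.
  have [x [[a ax] xW xK]] :
      exists x, [/\ exists a, wt a x, x \in W & x \notin K].
    apply: contrapT => no_x; case/negP: sWK.
    apply: subspace_wt => [t th w|a v vW av].
      move=> /WP[wM wK]; apply/WP; split=> [|k kK]; first exact: idM.
      have ktK : g k t \in K by rewrite bracketC memvN hK.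
      by rewrite bracketA memvD ?(hK t) ?wK.
    by apply: contraT => vK; case: no_x; exists v; split=> //; exists a.
  have /WP[xM Kx] := xW.
  have x0 : x != 0 by apply: contraNneq xK => ->; rewrite mem0v.
  have x_nil : locally_nilpotent g x := wt_nilpotent ax (wtM a x xM ax x0).
  have xKst : stabilizes g x K by move=> k kK; rewrite bracketC memvN Kx.
  exists (K + <[x]>)%VS; split.
  - by rewrite subv_add sKM -memvE.
  - apply: leq_ltn_trans dK _; rewrite ltn_neqAle dimvS ?addvSl // andbT.
    rewrite (dimv_leqif_sup (addvSl _ _)); apply: contra xK => /subvP; apply.
    exact/(subvP (addvSr _ _))/memv_line.
  - have sub k : k \in K -> k \in (K + <[x]>)%VS by apply/subvP/addvSl.
    move=> _ /memv_addP[k kK [_ /vlineP[c ->] ->]].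
    move=> _ /memv_addP[l lK [_ /vlineP[d ->] ->]].
    rewrite sub // bracketDl !bracketDr !bracketZl !bracketZr bracket_alternating.
    by rewrite !scaler0 addr0 !memvD ?(K_alg k kK l lK) ?memvZ ?Kx ?xKst.
  - move=> t th _ /memv_addP[l lK [_ /vlineP[d ->] ->]].
    by rewrite bracketDr bracketZr ax // memv_add ?(hK t) ?memvZ ?memv_line.
  - exact: has_null_vectors_extend.
have {dK sKM} KM : K = M by apply/eqP; rewrite eqEdim sKM.
(* With [U = 0] this gives a nonzero [w] in the center of [M]; but that center is an abelian ideal,
   hence zero. *)
have [|k _ u||w [wM w0 Mw]] := K_null 0%VS M.
- by rewrite subv0.
- by rewrite !memv0 => /eqP->; rewrite bracket0r.
- by move=> k _; apply: stabM.
have [Z ZP] : exists Z : {vspace L}, forall z,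
    z \in Z <-> z \in M /\ {in M, forall m, g m z = 0 :> L}.
  apply: vspace_comprehension => [|c u v [uM uK] [vM vK]].
    by split=> [|k _]; rewrite ?bracket0r ?mem0v.
  split=> [|k kK]; first by rewrite memvD ?memvZ.
  by rewrite bracketDr bracketZr uK ?vK // scaler0 addr0.
have Z0 : Z = 0%VS.
  apply: abelian_ideal0 => [z v /ZP[vM vZ]|u v /ZP[uM _] /ZP[_ ->] //].
  apply/ZP; split=> [|m mM]; first exact: idM.
  by rewrite bracketA (vZ m) // bracket0r addr0 vZ // bracketC memvN idM.
have /ZP : w \in M /\ {in M, forall m, g m w = 0}.
  by split=> // m; rewrite -KM => /Mw; rewrite memv0 => /eqP.
by rewrite Z0 (negPf w0).
Qed.

Lemma root_pairing a x : wt a x -> x != 0 -> nonzero_wt a ->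
  exists2 y, wt (fun t => - a t) y & g x y != 0.
Proof.
move=> ax x0 a0; apply: contrapT => /forall2NP no_y.
pose null u := exists b,
  [/\ wt b u, nonzero_wt b & forall y, wt (fun t => - b t) y -> g u y = 0].
have [X Xnull nullX] := span_pred null.
have x_null : null x.
  exists a; split=> // y ay; have [//|/negP] := no_y y.
  by rewrite negbK => /eqP.
suff MX0 : <<X>>%VS = 0%VS.
  by case/negP: x0; rewrite -memv0 -MX0 nullX.
(* By invariance, [b t] times the form at [(u, v)] is the form at [(t, [u, v])]. *)
have null_killing b u v :
    wt b u -> nonzero_wt b -> g u v = 0 -> killing g u v = 0.
  move=> bu [t th bt0] uv; apply: (mulfI bt0).
  by rewrite -killingZl -bu // killing_invariant uv killing0r mulr0.
have null_bracket c z u : wt c z -> null u -> g z u \in <<X>>%VS.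
  move=> cz [b [bu b0 u_null]].
  have [d0|d0] := pselect (nonzero_wt (fun t => c t + b t)); last first.
    rewrite bracketC u_null ?oppr0 ?mem0v //; apply: eq_wt cz => t th.
    apply/eqP; rewrite -addr_eq0; apply: contrapT => /negP dt.
    by apply: d0; exists t.
  apply: nullX; exists (fun t => c t + b t).
  split=> // [|w dw]; first exact: wt_bracket.
  (* To show [t = 0], it is enough that the form vanishes at [(t, t)]. By invariance this value is a
     multiple of the form at [(u, [z, w])], and [[z, w]] has weight [- b], so it commutes with the
     null vector [u]. *)
  set t := g (g z u) w; have zu := wt_bracket cz bu.
  have th : t \in h.
    by apply: wt0_cartan (wt_bracket zu dw) => s _; rewrite subrr.
  have tw : g t w = - (c t + b t) *: w by rewrite dw.
  apply: center0; apply: (ad_square_trace0 (erefl t) (zu t th) tw (h_diag th)).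
  - exact: wt_nilpotent zu d0.
  - apply: wt_nilpotent dw _; have [s sh s0] := d0.
    by exists s; rewrite ?oppr_eq0.
  have -> : lftrace (ad g t \o ad g t)%VF = killing g (g z u) (g w t).
    exact: killing_invariant.
  rewrite [g w t]bracketC tw scaleNr opprK killingZr.
  rewrite [g z u]bracketC -scaleN1r killingZl killing_invariant.
  rewrite (null_killing b) ?mulr0 // u_null //.
  apply: eq_wt (wt_bracket cz dw) => s sh.
  by rewrite opprD addrA subrr sub0r.
apply: ideal_no_wt0 => [z u uX|v]; last first.
  by apply: span_nonzero_wt_cartan => y /Xnull[b [? ? _]]; exists b.
have full_null y z' : null y -> g z' y \in <<X>>%VS.
  move=> y_null; rewrite bracketC memvN -adE memv_preim.
  have /subvP : (fullv <= ad g y @^-1: <<X>>)%VS.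
    apply: subspace_wt => [t _ s _|b v _ bv]; first exact: memvf.
    by rewrite -memv_preim adE bracketC memvN (null_bracket b).
  by apply; apply: memvf.
have /subvP : (<<X>> <= ad g z @^-1: <<X>>)%VS.
  by apply/span_subvP => y /Xnull y_null; rewrite -memv_preim adE full_null.
by move=> /(_ u uX); rewrite -memv_preim adE.
Qed.

(** If [a] vanished at [t = [x, y]], the trace criterion with [c = 0] would make [t] central, hence
    zero. So [y] can be rescaled to get the value 2. *)
Lemma sl2_triple a x : wt a x -> x != 0 -> nonzero_wt a ->
  exists y t, [/\ wt (fun t => - a t) y, t \in h, g x y = t & a t = 2].
Proof.
move=> ax x0 a0; have [y ay] := root_pairing ax x0 a0.
set t := g x y => t0.
have th : t \in h by apply: wt0_cartan (wt_bracket ax ay) => s _; rewrite subrr.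
have at0 : a t != 0.
  apply: contra_neq t0 => at0; apply: center0.
  apply: (@ad_square_trace0 _ _ _ x y t 0) => //.
  - by rewrite ax // at0.
  - by rewrite ay // at0.
  - exact: h_diag.
  - exact: wt_nilpotent ax a0.
  - apply: wt_nilpotent ay _; have [s sh s0] := a0.
    by exists s; rewrite ?oppr_eq0.
  - by rewrite mul0r.
have kh : (2 / a t) *: t \in h by rewrite memvZ.
exists ((2 / a t) *: y), ((2 / a t) *: t); split=> //; first exact: wtZ.
  by rewrite bracketZr.
(* As [a] is a bare function, its value at the multiple of [t] is read off from the action on
   [x]. *)
have /eqP := ax _ kh; rewrite bracketZl ax // scalerA mulfVK //.
by rewrite -subr_eq0 -scalerBl scaler_eq0 (negPf x0) orbF subr_eq0 => /eqP.
Qed.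

(* If v is a vector of maximal weight j.+2 a and w_k = (ad y)^k v, then
   w_(j.+2) lies in h, so [x, w_(j.+2)] is a multiple of x and is killed by ad x,
   while the ladder relations make [x, [x, w_(j.+2)]] a nonzero multiple of w_j. *)
Lemma wt_double a x v :
  wt a x -> x != 0 -> nonzero_wt a -> wt (fun t => a t + a t) v -> v = 0.
Proof.
move=> ax x0 a0 aav; apply/eqP; apply: contraT => v0.
have [y [t [ay th xy at2]]] := sl2_triple ax x0 a0.
have tx : g t x = 2 *: x by rewrite ax ?at2.
have ty : g t y = - 2 *: y by rewrite ay ?at2.
have [j vj Sj] := iter_last_nonzero (wt_nilpotent ax a0) v0.
set u := iter j (g x) v in vj Sj.
have uE s : s \in h -> g s u = (j.+2%:R * a s) *: u.
  move=> sh; rewrite (iter_eigen _ (ax s sh) (aav s sh)).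
  by congr (_ *: _); rewrite -!natr1; ring.
have tu : g t u = (j.+2%:R * 2) *: u by rewrite uE ?at2.
pose w k := iter k (g y) u.
have xw k : g x (w k.+1) = (k.+1%:R * (j.+2%:R * 2 - k%:R)) *: w k.
  rewrite /w (bracket_ladder xy ty _ Sj tu).
  by congr (_ *: _); field.
(* Nonzero since [k <= j + 2 < 2 (j + 2)]. *)
have coef0 k : (k <= j.+2)%N -> k.+1%:R * (j.+2%:R * 2 - k%:R) != 0 :> F.
  move=> le_k; rewrite mulf_neq0 ?pnatr_eq0 // -natrM subr_eq0 eqr_nat.
  by rewrite neq_ltn (leq_ltn_trans le_k) ?orbT // ltn_Pmulr.
have w0 k : (k <= j.+2)%N -> w k != 0.
  elim: k => [//|k IH] lt_k.
  have := coef0 k (ltnW lt_k); apply: contraNneq => wk.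
  have := xw k; rewrite wk bracket0r => /esym/eqP.
  by rewrite scaler_eq0 (negPf (IH (ltnW lt_k))) orbF.
have wh : w j.+2 \in h.
  apply: centralizer_cartan => s sh.
  have ys : g s y = - a s *: y := ay s sh.
  by rewrite /w (iter_eigen _ ys (uE s sh)) mulrN subrr scale0r.
have : g x (g x (w j.+2)) = 0.
  rewrite [g x (w _)]bracketC (ax _ wh) -scaleNr bracketZr.
  by rewrite bracket_alternating scaler0.
rewrite xw bracketZr xw scalerA => /eqP; rewrite scaler_eq0 mulf_eq0.
by rewrite !(negPf (coef0 _ _)) ?(negPf (w0 _ _)) // ?leqW.
Qed.

End Cartan.

(** * Roots *)

Section Roots.

Variables (F : numFieldType) (L : vectType F) (g : lie_algebra L).
Variable h : {vspace L}.
Hypotheses (g_semisimple : lie_semisimple g) (h_cartan : cartan_subalgebra g h).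
Implicit Types (a b c : dual h) (x v : L).

(** Projecting to [h] gives a functional on [h] the form that [wt] expects. *)
Definition root_weight a : L -> F := fun t => a (vsproj h t).

Lemma root_weight_opp a : root_weight (- a) =1 (fun t => - root_weight a t).
Proof. by move=> t; rewrite /root_weight opp_lfunE. Qed.

Lemma root_weightD a b :
  root_weight (a + b) =1 (fun t => root_weight a t + root_weight b t).
Proof. by move=> t; rewrite /root_weight add_lfunE. Qed.

Lemma lie_rootP a : lie_root g a <->
  nonzero_wt h (root_weight a) /\
  exists2 x, x != 0 & wt g h (root_weight a) x.
Proof.
split=> [[a0 [x x0 ax]]|[[t th at0] [x x0 ax]]]; split.
- have [s as0] : exists s, a s != (0 : 'Hom(subvs_of h, F^o)) s by apply/lfunPn.
  exists (vsval s); first exact: subvsP.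
  by rewrite /root_weight vsvalK; rewrite zero_lfunE in as0.
- exists x => // t th; have := ax (vsproj h t).
  by rewrite vsprojK.
- by apply: contraNneq at0 => ->; rewrite /root_weight zero_lfunE.
- exists x => // s; rewrite ax ?subvsP //.
  by rewrite /root_weight vsvalK.
Qed.

Lemma wt_lie_root a x :
  a != 0 -> x != 0 -> wt g h (root_weight a) x -> lie_root g a.
Proof.
move=> a0 x0 ax; split=> //; exists x => // s.
by rewrite ax ?subvsP // /root_weight vsvalK.
Qed.

Lemma lie_root_opp a : lie_root g a -> lie_root g (- a).
Proof.
move=> /[dup] ra /lie_rootP[a0 [x x0 ax]].
have [y ay xy] := root_pairing g_semisimple h_cartan ax x0 a0.
apply: (@wt_lie_root _ y); first by case: ra; rewrite oppr_eq0.
  by apply: contra_neq xy => ->; rewrite bracket0r.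
by apply: eq_wt ay => t _; rewrite root_weight_opp.
Qed.

Lemma lie_root_double a : lie_root g a -> ~ lie_root g (a + a).
Proof.
move=> /lie_rootP[a0 [x x0 ax]] /lie_rootP[_ [v /negP v0 av]].
apply: v0; apply/eqP; apply: (wt_double g_semisimple h_cartan ax x0 a0).
by apply: eq_wt av => t _; rewrite root_weightD.
Qed.

(** [s] is the middle element of an sl2-triple for [a]. If [a + b] is neither 0 nor a root, root
    vectors of [b] are highest weight vectors for this triple. *)
Lemma lie_root_coroot a : lie_root g a -> exists2 s : subvs_of h, a s = 2 &
  forall b, lie_root g b -> a + b != 0 -> ~ lie_root g (a + b) ->
    exists n : nat, b s = n%:R.
Proof.
move=> /lie_rootP[a0 [x x0 ax]].
have [y [t [ay th xy at2]]] := sl2_triple g_semisimple h_cartan ax x0 a0.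
exists (vsproj h t) => // b /lie_rootP[b0 [v v0 bv]] ab0 ab.
have xv : g x v = 0.
  apply/eqP; apply: contraT => xv0; case: ab; apply: wt_lie_root xv0 _ => //.
  by apply: eq_wt (wt_bracket ax bv) => s _; rewrite root_weightD.
have ty : g t y = - 2 *: y by rewrite ay ?at2.
have y_nil : locally_nilpotent g y.
  apply: (wt_nilpotent h_cartan ay); have [s sh s0] := a0.
  by exists s; rewrite ?oppr_eq0.
have [n nE] := highest_weight_nat xy ty y_nil v0 xv (bv t th).
exists n; apply: (@mulIf F 2); first by rewrite pnatr_eq0.
by rewrite -nE mulr_natr.
Qed.

(* If a + b is neither 0 nor a root for every later term b of a zero sum
   starting with a, evaluating at the coroot of a gives 2 plus natural numbers. *)
Lemma closed_antisymmetric_sum_neq0 (S : dual h -> Prop) :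
    (forall a, S a -> lie_root g a) ->
    (forall a b, S a -> S b -> lie_root g (a + b) -> S (a + b)) ->
    (forall a, S a -> ~ S (- a)) ->
  forall l : seq (dual h), l != [::] -> (forall a, a \in l -> S a) ->
    \sum_(a <- l) a != 0.
Proof.
move=> Sroot Sadd Sopp l; have [n] := ubnP (size l).
elim: n l => // n IH [//|a l] /= ltn _ Sl; rewrite big_cons.
have Sa : S a by apply: Sl; rewrite mem_head.
have {}Sl b : b \in l -> S b by move=> bl; apply: Sl; rewrite inE bl orbT.
have [[b [bl Sab]]|no_b] := pselect (exists b, b \in l /\ S (a + b)).
  (* Replacing the entries [a] and [b] by [a + b] keeps the sum. *)
  rewrite (big_rem b) //= addrA -(big_cons _ _ _ _ xpredT id).
  apply: IH => [|//|c].
    by rewrite /= size_rem // prednK // -has_predT; apply/hasP; exists b.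
  by rewrite inE => /predU1P[->//|/mem_rem/Sl].
have [s as2 sP] := lie_root_coroot (Sroot a Sa).
have [m mE] : exists m : nat, (\sum_(b <- l) b) s = m%:R.
  have {}no_b b : b \in l -> ~ S (a + b) by move=> bl Sb; apply: no_b; exists b.
  elim: l {ltn} Sl no_b => [|b l IHl] Sl no_b.
    by exists 0%N; rewrite big_nil zero_lfunE.
  have [c cl|c cl|m mE] := IHl; [by apply: Sl; rewrite inE cl orbT|
    by apply: no_b; rewrite inE cl orbT|].
  have Sb : S b by apply: Sl; rewrite mem_head.
  have [|r|k kE] := sP b (Sroot b Sb).
  - apply/eqP => /eqP; rewrite addrC addr_eq0 => /eqP ba.
    by apply: (Sopp a); rewrite -?ba.
  - exact/(no_b b (mem_head _ _))/Sadd.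
  - by exists (k + m)%N; rewrite big_cons add_lfunE mE kE natrD.
apply/eqP => /(congr1 (fun f : dual h => f s)).
rewrite add_lfunE as2 mE zero_lfunE; move/eqP.
by rewrite -natrD pnatr_eq0.
Qed.

End Roots.

(** * The basis graph *)

Section SymmetricDifference.

Variable T : finType.
Implicit Types (s t : {set T}) (x y z : T).

Definition symdiff s t := (s :\: t) :|: (t :\: s).

Lemma symdiffC s t : symdiff s t = symdiff t s.
Proof. exact: setUC. Qed.

(** Measures a move along an edge: two elements leave the symmetric difference and at most one
    enters. *)
Lemma card_replace2 (D D' : {set T}) x y z : x \in D -> y \in D -> x != y ->
  D' \subset z |: (D :\ x :\ y) -> (#|D'| < #|D|)%N.
Proof.
move=> xD yD xy /subset_leq_card/leq_ltn_trans; apply.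
rewrite (cardsD1 x D) xD (cardsD1 y (D :\ x)) !inE eq_sym xy yD /=.
by rewrite cardsU1 !add1n ltnS -add1n leq_add2r leq_b1.
Qed.

End SymmetricDifference.

(** * Edges, weights and descent on the symmetric difference *)

Section BasisGraph.

Variables (R : realType) (L : vectType R[i]) (g : lie_algebra L).
Variables (h : {vspace L}) (Rp : {fset dual h}).
Hypotheses (g_semisimple : lie_semisimple g) (h_cartan : cartan_subalgebra g h).
Hypothesis Rp_positive : positive_root_system g Rp.
Implicit Types (s t u : {set Rp}) (e : Rp).

Local Notation edge := (@basis_edge R L h Rp).

Lemma edge_sym : symmetric edge.
Proof.
by move=> s t; apply/eq_existsb => e; apply/eq_existsb => e1;
  apply/eq_existsb => e2; rewrite orbC.
Qed.

Lemma edge_merge s e e1 e2 : val e = val e1 + val e2 ->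
  e1 \in s -> e2 \in s -> e \notin s -> edge s (e |: (s :\: [set e1; e2])).
Proof.
move=> ee e1s e2s es; apply/existsP; exists e; apply/existsP; exists e1.
apply/existsP; exists e2; rewrite ee eqxx /=; apply/orP; right.
have e1e : e1 != e by apply: contraNneq es => <-.
have e2e : e2 != e by apply: contraNneq es => <-.
apply/andP; split; apply/eqP/setP => z; rewrite !inE.
  case: (eqVneq z e) => [->|_] /=; first by rewrite es.
  by case: (z \in s); rewrite ?andbF.
case: (eqVneq z e1) => [->|_] /=; first by rewrite (negPf e1e) e1s.
case: (eqVneq z e2) => [->|_] /=; first by rewrite (negPf e2e) e2s.
by case: (z \in s); rewrite ?orbT ?andbF.
Qed.

Lemma edge_split s e e1 e2 : val e = val e1 + val e2 ->
  e \in s -> e1 \notin s -> e2 \notin s -> edge s ([set e1; e2] :|: (s :\ e)).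
Proof.
move=> ee es e1s e2s; rewrite edge_sym.
have e1e : e != e1 by apply: contraNneq e1s => <-.
have e2e : e != e2 by apply: contraNneq e2s => <-.
set t := _ :|: _; have -> : s = e |: (t :\: [set e1; e2]).
  apply/setP => z; rewrite !inE; case: (eqVneq z e) => [->//|_] /=.
  case: (eqVneq z e1) => [->|_] /=; first exact: negPf.
  by case: (eqVneq z e2) => [->|_] /=; first exact: negPf.
by apply: edge_merge; rewrite // !inE ?eqxx ?orbT // (negPf e1e) (negPf e2e).
Qed.

Lemma pos_root e : lie_root g (val e).
Proof. by have [Rp_root _ _] := Rp_positive; apply/Rp_root/valP. Qed.

(** Twice a root is not a root. Hence [[set e1; e2]] really has two elements, and edges preserve the
    weight. *)
Lemma pos_summands_neq e e1 e2 : val e = val e1 + val e2 -> e1 != e2.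
Proof.
move=> ee; apply/negP => /eqP e12.
apply: (lie_root_double g_semisimple h_cartan (pos_root e1)).
by rewrite {2}e12 -ee; apply: pos_root.
Qed.

Lemma root_pos_or_neg (a : dual h) : lie_root g a ->
  (exists e : Rp, val e = a) \/ (exists e : Rp, val e = - a).
Proof.
have [_ Rp_dich _] := Rp_positive => /Rp_dich.
have [aRp _|_ /= aRp] := boolP (a \in Rp).
  by left; exists [` aRp]%fset.
by right; exists [` aRp]%fset.
Qed.

Lemma omega_eq s t : omega s = omega t <->
  \sum_(e in s :\: t) val e = \sum_(e in t :\: s) val e.
Proof.
rewrite /omega (big_setID t) (big_setID s (A := t)) /= [t :&: s]setIC.
split=> [/addrI/oppr_inj/addrI //|->//].
Qed.

Lemma edge_omega s t : edge s t -> omega s = omega t.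
Proof.
move=> /existsP[e /existsP[e1 /existsP[e2 /andP[/eqP ee]]]].
have e12 := pos_summands_neq ee.
by case/orP => /andP[/eqP st /eqP ts]; apply/omega_eq; rewrite st ts;
  rewrite big_set1 big_setU1 ?inE //= big_set1.
Qed.

(** Either end may move, since the useful edge may exist at only one of them. *)
Definition reducible s t := exists u,
  edge s u /\ (#|symdiff u t| < #|symdiff s t|)%N \/
  edge t u /\ (#|symdiff s u| < #|symdiff s t|)%N.

Lemma reducibleC s t : reducible s t -> reducible t s.
Proof.
move=> [u ustP]; exists u; rewrite ![symdiff t _]symdiffC [symdiff u s]symdiffC.
by case: ustP; [right|left].
Qed.

(** If [e] is outside [s], merge [e1] and [e2] in [s]. Otherwise [e] is in [t] too, and it can be
    split in [t]. Both ways [e1] and [e2] leave the symmetric difference, and only [e] can enter. *)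
Lemma reducible_merge s t e e1 e2 : val e = val e1 + val e2 ->
  e1 \in s :\: t -> e2 \in s :\: t -> e \notin s :\: t -> reducible s t.
Proof.
move=> ee; rewrite !inE => /andP[e1t e1s] /andP[e2t e2s].
have e12 := pos_summands_neq ee.
have De1 : e1 \in symdiff s t by rewrite !inE e1s e1t.
have De2 : e2 \in symdiff s t by rewrite !inE e2s e2t.
have [es /= |es _] := boolP (e \in s).
  rewrite andbT negbK => et.
  exists ([set e1; e2] :|: (t :\ e)); right; split; first exact: edge_split.
  apply: (card_replace2 (z := e) De1 De2 e12); apply/subsetP => z.
  rewrite /symdiff !inE.
  case: (eqVneq z e) => //= _; case: (eqVneq z e1) => [->|_] /=.
    by rewrite e1s.
  by case: (eqVneq z e2) => [->|_] /=; first by rewrite e2s.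
exists (e |: (s :\: [set e1; e2])); left; split; first exact: edge_merge.
apply: (card_replace2 (z := e) De1 De2 e12); apply/subsetP => z.
rewrite /symdiff !inE.
case: (eqVneq z e) => //= _; case: (eqVneq z e1) => [->|_] /=.
  by rewrite (negPf e1t) ?andbF.
by case: (eqVneq z e2) => [->|_] /=; first by rewrite (negPf e2t).
Qed.

(** If [e2] is outside [s], split [e] in [s]. Otherwise [e2] is in [t] too, and [e1] and [e2] can be
    merged in [t]. Both ways [e] and [e1] leave, and only [e2] can enter. *)
Lemma reducible_split s t e e1 e2 : val e = val e1 + val e2 ->
  e \in s :\: t -> e1 \in t :\: s -> e2 \notin s :\: t -> reducible s t.
Proof.
move=> ee; rewrite !inE => /andP[et es] /andP[e1s e1t].
have e1e : e != e1 by apply: contraNneq e1s => <-.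
have De : e \in symdiff s t by rewrite !inE es et.
have De1 : e1 \in symdiff s t by rewrite !inE e1s e1t orbT.
have [e2s /= |e2s _] := boolP (e2 \in s).
  rewrite andbT negbK => e2t.
  exists (e |: (t :\: [set e1; e2])); right; split; first exact: edge_merge.
  apply: (card_replace2 (z := e2) De De1 e1e); apply/subsetP => z.
  rewrite /symdiff !inE.
  case: (eqVneq z e2) => //= _; case: (eqVneq z e) => [->|_] /=.
    by rewrite es.
  by case: (eqVneq z e1) => [->|_] /=; first by rewrite (negPf e1s).
exists ([set e1; e2] :|: (s :\ e)); left; split; first exact: edge_split.
apply: (card_replace2 (z := e2) De De1 e1e); apply/subsetP => z.
rewrite /symdiff !inE.
case: (eqVneq z e2) => //= _; case: (eqVneq z e) => [->|_] /=.
  by rewrite (negPf e1e) (negPf et).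
by case: (eqVneq z e1) => [->|_] /=; first by rewrite e1t.
Qed.

Lemma omega_reducible s t : s != t -> omega s = omega t -> reducible s t.
Proof.
move=> neq_st /omega_eq st; apply: contrapT => irred.
pose S (v : dual h) := (exists2 a, a \in s :\: t & v = val a) \/
                       (exists2 b, b \in t :\: s & v = - val b).
have S_root v : S v -> lie_root g v.
  case=> [[a _ ->]|[b _ ->]]; first exact: pos_root.
  exact/(lie_root_opp g_semisimple h_cartan)/pos_root.
have [_ Rp_dich Rp_add] := Rp_positive.
have S_opp v : S v -> ~ S (- v).
  have no_opp (a b : Rp) : val a <> - val b.
    by move=> ab; have := Rp_dich _ (pos_root b); rewrite -ab !fsvalP.
  case=> [[a ast ->]|[b bst ->]] [[a' ast' eq_v]|[b' bst' eq_v]].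
  - by case: (no_opp a' a).
  - move/oppr_inj/val_inj: eq_v => eq_v; move: ast bst'; rewrite eq_v !inE.
    by case: (b' \in s); rewrite ?andbF.
  - rewrite opprK in eq_v; move/val_inj: eq_v => eq_v; move: bst ast'.
    by rewrite eq_v !inE; case: (a' \in s); rewrite ?andbF.
  - by rewrite opprK in eq_v; case: (no_opp b b').
(* For a positive root [c], either [a = b + c] or [b = a + c]; irreducibility forces [c] into the
   same difference set as the root that is split. *)
have S_add_mixed (a b : Rp) : a \in s :\: t -> b \in t :\: s ->
    lie_root g (val a - val b) -> S (val a - val b).
  move=> ast bts /root_pos_or_neg[[c cE]|[c cE]].
    left; exists c => //; apply: contrapT => /negP cst; case: irred.
    by apply: (reducible_split _ ast bts cst); rewrite cE addrC subrK.
  right; exists c; last by rewrite cE opprK.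
  apply: contrapT => /negP cts; case: irred; apply: reducibleC.
  by apply: (reducible_split _ bts ast cts); rewrite cE opprB addrC subrK.
have S_add v w : S v -> S w -> lie_root g (v + w) -> S (v + w).
  case=> [[a ast ->]|[b bts ->]] [[a' ast' ->]|[b' bts' ->]] vw.
  - have cRp := Rp_add _ _ (valP a) (valP a') vw.
    left; exists [` cRp]%fset => //; apply: contrapT => /negP cst; case: irred.
    exact: (reducible_merge _ ast ast' cst).
  - exact: S_add_mixed.
  - by move: vw; rewrite addrC; apply: S_add_mixed.
  - move: vw; rewrite -opprD => /(lie_root_opp g_semisimple h_cartan).
    rewrite opprK => /(Rp_add _ _ (valP b) (valP b')) cRp.
    right; exists [` cRp]%fset => //; apply: contrapT => /negP cts; case: irred.
    by apply: reducibleC; apply: (reducible_merge _ bts bts' cts).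
(* All of [S] as a list: nonempty because [s] and [t] differ, of sum zero because their weights
   agree. *)
pose l := [seq val a | a <- enum (s :\: t)]
       ++ [seq - val b | b <- enum (t :\: s)].
have : \sum_(v <- l) v != 0.
  apply: (closed_antisymmetric_sum_neq0 g_semisimple h_cartan S_root S_add S_opp).
    apply: contra_neq neq_st => l0; apply/eqP; rewrite eqEsubset -!setD_eq0.
    have /eqP := congr1 size l0; rewrite size_cat !size_map -!cardE addn_eq0.
    by rewrite !cards_eq0.
  move=> v; rewrite mem_cat => /orP[] /mapP[c]; rewrite mem_enum => cst ->.
    by left; exists c.
  by right; exists c.
by rewrite big_cat !big_map !big_enum /= sumrN st subrr eqxx.
Qed.

(** Induction on the size of the symmetric difference; the vertex reached by a reducing edge has the
    same weight. *)
Lemma weight_vertices_connected (a : dual h) :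
  {in weight_vertices Rp a &, forall s t,
    connect [rel u v | [&& u \in weight_vertices Rp a,
                          v \in weight_vertices Rp a & edge u v]] s t}.
Proof.
move=> s t; have [n] := ubnP #|symdiff s t|.
elim: n s t => // n IH s t; rewrite ltnS => le_n sa ta.
have [->|neq_st] := eqVneq s t; first exact: connect0.
have := sa; have := ta; rewrite !inE => /eqP ot /eqP os.
have [|u [[su lt_u]|[tu lt_u]]] := omega_reducible neq_st; first by rewrite os ot.
  have ua : u \in weight_vertices Rp a by rewrite inE -(edge_omega su) os.
  apply: connect_trans (connect1 _) (IH u t (leq_trans lt_u le_n) ua ta).
  exact/and3P.
have ua : u \in weight_vertices Rp a by rewrite inE -(edge_omega tu) ot.
apply: connect_trans (IH s u (leq_trans lt_u le_n) sa ua) (connect1 _).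
by apply/and3P; rewrite edge_sym.
Qed.

Lemma connect_omega s t : connect edge s t = (omega s == omega t).
Proof.
apply/idP/eqP => [/connectP[p]|st].
  elim: p s => [s _ ->//|u p IH s /= /andP[/edge_omega-> up] tE].
  exact: IH.
apply: (connect_sub _ (@weight_vertices_connected (omega s) s t _ _)) => [u v||].
- by case/and3P => _ _ /connect1.
- by rewrite inE.
- by rewrite inE st.
Qed.

End BasisGraph.

Theorem theorem5p3 (R : realType) (L : vectType R[i]) (g : lie_algebra L)
    (h : {vspace L}) (Rp : {fset dual h})
    (g_semisimple : lie_semisimple g)
    (h_cartan : cartan_subalgebra g h)
    (Rp_positive : positive_root_system g Rp) :
  connected_components (basis_edge (Rp := Rp)) = weight_decomposition Rp /\
  forall a : dual h, a \in weight_set Rp ->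
    connected_subgraph (basis_edge (Rp := Rp)) (weight_vertices Rp a).
Proof.
have connE := connect_omega g_semisimple h_cartan Rp_positive.
have weight_mem (s : {set Rp}) : omega s \in weight_set Rp by apply/imfsetP; exists s.
have componentE (s : {set Rp}) :
  [set t in [set: {set Rp}] | connect (basis_edge (Rp := Rp)) s t]
    = weight_vertices Rp (omega s).
  by apply/setP => t; rewrite !inE connE eq_sym.
split=> [|a /imfsetP[s _ ->]]; last first.
  split; first by apply/set0Pn; exists s; rewrite inE.
  exact: (weight_vertices_connected g_semisimple h_cartan Rp_positive).
apply/setP => X; apply/imsetP/imsetP => [[s _ ->]|[a _ ->]].
  by exists [` weight_mem s]%fset; rewrite ?componentE.
have /imfsetP[s _ /= ->] := valP a.
by exists s; rewrite ?inE ?componentE.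
Qed.
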